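(* Let $D$ be a $4\times4$ Euclidean distance matrix with embedding dimension $3$, with generating points $p^1,\ldots,p^4\in\mathbb{R}^3$ affinely spanning $\mathbb{R}^3$ and satisfying $\sum_{i=1}^4 p^i=\mathbf{0}$. Let $P$ be the $4\times 3$ matrix whose $i$-th row is $(p^i)^T$, let $B=PP^T$, $b=\mathrm{diag}(B)$, and let $B^{\dagger}$ be the Moore-Penrose inverse of $B$. Let $B^{\dagger}=S\Lambda S^T$ be a spectral decomposition, with $\Lambda$ the diagonal matrix of the eigenvalues $\mu_1\ge\mu_2\ge\mu_3>\mu_4=0$ and $S$ orthogonal with columns $s^1,s^2,s^3,s^4$, where $s^4=e/2$. Let $d^m\in\mathbb{R}^4$, let $\kappa_4(d^m)=e^T(d^m-b)-(d^m-b)^TB^{\dagger}(d^m-b)$, and let $c=-\Lambda S^T(d^m-b)+\frac12S^Te$. Assume $c_1\ne0$, and define $$g(\lambda)=\sum_{i=1}^3\frac{c_i^2}{\mu_i(1-\lambda\mu_i)^2}+2\lambda-h,\qquad h=\kappa_4(d^m)+\sum_{i=1}^3\frac{c_i^2}{\mu_i},\qquad \lambda<\frac1{\mu_1}.$$ Then $g$ is strictly increasing on $(-\infty,1/\mu_1)$ and has a unique root $\lambda^*$ in this interval; moreover $\lambda^*=0$ if $\kappa_4(d^m)=0$, $\lambda^*\in(0,1/\mu_1)$ if $\kappa_4(d^m)>0$, and $\lambda^*\in(\frac12\kappa_4(d^m),0)$ if $\kappa_4(d^m)<0$. The optimal solution of the problem $$\min_{y\in\mathbb{R}^4}\ \|y-d^m\|^2\quad\text{subject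 to}\quad\begin{bmatrix}0&y^T\\ y&D\end{bmatrix}\text{ is an EDM of embedding dimension }3$$ is $$y^*=-\lambda^*S(I-\lambda^*\Lambda)^{-1}c+d^m.$$ In particular, if $\kappa_4(d^m)=0$ then $y^*=d^m$.
   Context: An $n\times n$ matrix $D=(d_{ij})$ is a Euclidean distance matrix (EDM) if there are points $p^1,\ldots,p^n$ (generating points of $D$) in some Euclidean space with $d_{ij}=\|p^i-p^j\|^2$ for all $i,j$; the dimension of their affine span is the embedding dimension of $D$. Here $e$ is the all-ones vector, $I$ the identity matrix, $\mathrm{diag}(B)$ the vector of diagonal entries of $B$, $c_i$ the $i$-th entry of $c$, and $\|\cdot\|$ the Euclidean norm. *)

(* Defs.v *)
From HB Require Import structures.
From mathcomp Require Import all_boot all_order all_algebra.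
From mathcomp Require Import reals.

Set Implicit Arguments.
Unset Strict Implicit.
Unset Printing Implicit Defensive.

Import Order.TTheory GRing.Theory Num.Theory.

Local Open Scope ring_scope.

Section EuclideanDistanceMatrices.
Variable R : realType.

(* The library's norm `|v| on matrices is the sup norm, not this one. *)
Definition enorm n (v : 'cV[R]_n) : R := Num.sqrt (\sum_i v i 0 ^+ 2).

Definition generating_points n r (D : 'M[R]_n) (p : 'I_n -> 'cV[R]_r) : Prop :=
  forall i j, D i j = enorm (p i - p j) ^+ 2.

(* The direction space of the affine span of the points is the linear span of
   their pairwise differences (taken as row vectors). *)
Definition aff_dim n r (p : 'I_n -> 'cV[R]_r) : nat :=
  \rank (\sum_(ij : 'I_n * 'I_n) <<(p ij.1 - p ij.2)^T>>)%MS.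

(* The value of k does not depend on the generating points: any two families
   with the same pairwise distances have affine spans of equal dimension. *)
Definition is_edm_of_dim n (D : 'M[R]_n) (k : nat) : Prop :=
  exists (r : nat) (p : 'I_n -> 'cV[R]_r),
    generating_points D p /\ aff_dim p = k.

(* The four Penrose conditions, which determine X uniquely. *)
Definition is_moore_penrose m n (A : 'M[R]_(m, n)) (X : 'M[R]_(n, m)) : Prop :=
  [/\ A *m X *m A = A, X *m A *m X = X,
      (A *m X)^T = A *m X & (X *m A)^T = X *m A].

Definition is_minimizer (T : Type) (feasible : T -> Prop) (f : T -> R) (x : T)
  : Prop :=
  feasible x /\ forall z, feasible z -> f x <= f z.

End EuclideanDistanceMatrices.

(* Main.v *)
Require Import Defs.
From HB Require Import structures.
From mathcomp Require Import all_boot all_order all_algebra.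
From mathcomp Require Import reals.
From mathcomp Require Import ring lra.

Set Implicit Arguments.
Unset Strict Implicit.
Unset Printing Implicit Defensive.

Import Order.TTheory GRing.Theory Num.Theory.

Local Open Scope ring_scope.

(* Centred points are determined by their distances up to their Gram matrix B,
   and B Bdag is the projection orthogonal to e, so z extends D without raising
   the embedding dimension iff z - b = |x|^2 e - 2 P x for some x, which amounts
   to kappa_4(z) = 0. In the coordinates u = S^T (z - dm) this is the quadric
   sum_i (mu_i u_i^2 - 2 c_i u_i) = kappa_4(dm), and one minimises |u|^2 on it.
   For lambda < 1 / mu_1 the Lagrangian is a positive definite quadratic in u
   with vertex v_i = - lambda c_i / (1 - lambda mu_i), so v is the unique
   minimiser as soon as it lies on the quadric, and that is g(lambda) = 0. *)

(** * Point configurations, centred Gram matrices and direction spaces *)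

Section Configurations.
Variable R : realType.

Definition points_mx n r (p : 'I_n -> 'cV[R]_r) : 'M[R]_(n, r) :=
  \matrix_(i < n) (p i)^T.

(** Its rank is [aff_dim p]; naming the matrix lets inclusions of row spaces be stated. *)
Definition direction_mx n r (p : 'I_n -> 'cV[R]_r) : 'M[R]_r :=
  (\sum_(ij : 'I_n * 'I_n) <<(p ij.1 - p ij.2)^T>>)%MS.

Lemma enorm_sqE n (v : 'cV[R]_n) : enorm v ^+ 2 = \sum_i v i 0 ^+ 2.
Proof. by rewrite sqr_sqrtr// sumr_ge0// => i _; apply: sqr_ge0. Qed.

Lemma enorm_sq_mul n (v : 'cV[R]_n) : enorm v ^+ 2 = (v^T *m v) 0 0.
Proof. by rewrite enorm_sqE mxE; apply: eq_bigr => i _; rewrite mxE expr2. Qed.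

Lemma enorm_sqB n (u v : 'cV[R]_n) :
  enorm (u - v) ^+ 2 = enorm u ^+ 2 + enorm v ^+ 2 - 2 * (u^T *m v) 0 0.
Proof.
rewrite !enorm_sqE mxE mulr_sumr -sumrN -!big_split /=.
by apply: eq_bigr => i _; rewrite !mxE; ring.
Qed.

Lemma points_mx_mulE n r (p : 'I_n -> 'cV[R]_r) (x : 'cV[R]_r) i :
  (points_mx p *m x) i 0 = ((p i)^T *m x) 0 0.
Proof. by rewrite !mxE; apply: eq_bigr => k _; rewrite !mxE. Qed.

Lemma gramE n r (p : 'I_n -> 'cV[R]_r) i j :
  (points_mx p *m (points_mx p)^T) i j = ((p i)^T *m p j) 0 0.
Proof. by rewrite !mxE; apply: eq_bigr => k _; rewrite !mxE. Qed.

Lemma gram_row_sum n r (p : 'I_n -> 'cV[R]_r) i :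
  \sum_j p j = 0 -> \sum_j (points_mx p *m (points_mx p)^T) i j = 0.
Proof.
move=> p0; under eq_bigr do rewrite gramE.
by rewrite -summxE -mulmx_sumr p0 mulmx0 mxE.
Qed.

(** The difference [E] of the Gram matrices satisfies [E i i + E j j = 2 * E i j] and has zero row
    sums. Summing over [j] gives [n * E i i = - t] with [t] the trace; summing over [i] gives
    [n * t = - n * t]. So the diagonal vanishes, and then all of [E]. *)
Lemma centered_gram_unique n r s (p : 'I_n -> 'cV[R]_r) (q : 'I_n -> 'cV[R]_s)
    (D : 'M[R]_n) :
  generating_points D p -> generating_points D q ->
  \sum_i p i = 0 -> \sum_i q i = 0 ->
  points_mx p *m (points_mx p)^T = points_mx q *m (points_mx q)^T.
Proof.
move=> Dp Dq p0 q0.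
pose G := points_mx p *m (points_mx p)^T.
pose H := points_mx q *m (points_mx q)^T.
pose E i j := G i j - H i j.
have EE i j : E i i + E j j = 2 * E i j.
  have := Dq i j; rewrite (Dp i j) !enorm_sqB !enorm_sq_mul -!gramE /E => eqD.
  by rewrite -/G -/H in eqD; lra.
have E0 i : \sum_j E i j = 0.
  by rewrite /E sumrB !gram_row_sum ?subr0.
pose t := \sum_i E i i.
have Ediag i : E i i *+ n = - t.
  apply/eqP; rewrite -addr_eq0; apply/eqP.
  have <- : \sum_(j < n) (E i i + E j j) = E i i *+ n + t.
    by rewrite big_split /= sumr_const card_ord.
  by under eq_bigr do rewrite EE; rewrite -mulr_sumr E0 mulr0.
have t0 : t *+ n = 0.
  have tn : t *+ n = - (t *+ n).
    rewrite -mulNrn -[in RHS](card_ord n) -sumr_const /t -sumrMnl.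
    by apply: eq_bigr.
  by move: tn; move: (t *+ n) => a aN; lra.
apply/matrixP => i j; apply/eqP; rewrite -/G -/H -subr_eq0 -/(E i j).
have n_gt0 : (0 < n)%N by case: (n) i => [[]|].
have nz (a : R) : a *+ n = 0 -> a = 0.
  by move/eqP; rewrite mulrn_eq0 eqn0Ngt n_gt0 => /eqP.
have {}Ediag k : E k k = 0 by apply/nz; rewrite Ediag (nz _ t0) oppr0.
by move: (EE i j); rewrite !Ediag => Eij; apply/eqP; lra.
Qed.

(** The vector is the average of the differences [q l - q (f i)]. *)
Lemma sub_centroid_direction n m r (q : 'I_n -> 'cV[R]_r)
    (f : 'I_m.+1 -> 'I_n) l :
  ((q l - m.+1%:R^-1 *: \sum_i q (f i))^T <= direction_mx q)%MS.
Proof.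
have -> : q l - m.+1%:R^-1 *: \sum_i q (f i) =
    m.+1%:R^-1 *: \sum_i (q l - q (f i)).
  rewrite sumrB scalerBr sumr_const card_ord -scaler_nat scalerA mulVf ?scale1r//.
  by rewrite pnatr_eq0.
rewrite linearZ scalemx_sub// linear_sum summx_sub// => i _.
by rewrite (sumsmx_sup (l, f i))// genmxE.
Qed.

Lemma points_mx_sub_direction n m r (q : 'I_n -> 'cV[R]_r)
    (f : 'I_m.+1 -> 'I_n) :
  (points_mx (fun i => (q (f i) - m.+1%:R^-1 *: \sum_j q (f j))) <=
   direction_mx q)%MS.
Proof. by apply/row_subP => i; rewrite rowK sub_centroid_direction. Qed.

End Configurations.

(** * Adding one point without raising the embedding dimension *)

Section Feasibility.
Variables (R : realType) (n : nat) (D : 'M[R]_n.+1) (p : 'I_n.+1 -> 'cV[R]_n).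
Variable Bdag : 'M[R]_n.+1.

Let e : 'cV[R]_n.+1 := const_mx 1.
Let B := points_mx p *m (points_mx p)^T.
Let b : 'cV[R]_n.+1 := \col_i B i i.

Hypothesis Dp : generating_points D p.
Hypothesis p0 : \sum_i p i = 0.
Hypothesis BdagT : Bdag^T = Bdag.
Hypothesis BdagB : Bdag *m B *m Bdag = Bdag.
Hypothesis BBdag : B *m Bdag = 1%:M - n.+1%:R^-1 *: (e *m e^T).

Let nS_neq0 : n.+1%:R != 0 :> R. Proof. by rewrite pnatr_eq0. Qed.

Lemma ones_mul (v : 'cV[R]_n.+1) : (e^T *m v) 0 0 = \sum_i v i 0.
Proof. by rewrite mxE; apply: eq_bigr => i _; rewrite !mxE mul1r. Qed.

Lemma ones_sq : e^T *m e = n.+1%:R%:M.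
Proof.
rewrite [LHS]mx11_scalar ones_mul; congr _%:M.
by under eq_bigr do rewrite mxE; rewrite sumr_const card_ord.
Qed.

Lemma ones_points_mx m (q : 'I_n.+1 -> 'cV[R]_m) :
  \sum_i q i = 0 -> e^T *m points_mx q = 0.
Proof.
move=> q0; apply/matrixP => i j.
transitivity ((\sum_i q i) j 0); last by rewrite q0 !mxE.
rewrite mxE summxE; apply: eq_bigr => k _.
by rewrite !mxE mul1r.
Qed.

Lemma dag_ones : Bdag *m e = 0.
Proof.
rewrite -BdagB -(mulmxA Bdag) BBdag -mulmxA mulmxBl mul1mx -scalemxAl -mulmxA.
rewrite ones_sq mul_mx_scalar scalerA mulVf// scale1r subrr mulmx0//.
Qed.

Lemma gram_dag_gram : B *m Bdag *m B = B.
Proof.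
rewrite BBdag mulmxBl mul1mx -scalemxAl -mulmxA (mulmxA e^T) ones_points_mx//.
by rewrite mul0mx mulmx0 scaler0 subr0.
Qed.

(** The identity is [B *m Bdag] plus a matrix of rank at most one. Full dimensionality of the old
    points enters the argument here. *)
Lemma rank_gram_ge : (n <= \rank B)%N.
Proof.
have := mxrank_add (B *m Bdag) (n.+1%:R^-1 *: (e *m e^T)).
rewrite BBdag subrK mxrank1 -BBdag => le1.
rewrite -ltnS (leq_trans le1)// -[X in (_ <= X)%N]addn1 leq_add// ?mxrankM_maxl//.
rewrite (leq_trans (mxrank_scale _ _))//.
exact: leq_trans (mxrankM_maxl _ _) (rank_leq_col _).
Qed.

(** [b] lists the squared norms of any family with Gram matrix [B]; the lemma serves both [p] and
    the recentred points of a given extension. *)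
Lemma sqdist_vectorE m (q : 'I_n.+1 -> 'cV[R]_m) (x : 'cV[R]_m) :
  points_mx q *m (points_mx q)^T = B ->
  \col_i (enorm (q i - x) ^+ 2) - b =
    enorm x ^+ 2 *: e - 2 *: (points_mx q *m x).
Proof.
move=> qB; apply/colP => i.
have bE : b i 0 = enorm (q i) ^+ 2 by rewrite mxE -qB gramE enorm_sq_mul.
rewrite mxE [X in _ + X]mxE bE mxE enorm_sqB.
rewrite [RHS]mxE [in RHS]mxE [X in _ = _ * X + _]mxE [X in _ = _ + X]mxE.
by rewrite [X in _ = _ - X]mxE points_mx_mulE; ring.
Qed.

(* For n = 3 the right-hand side is kappa_4(z) = 0. *)
Lemma edm_extensionP (z : 'cV[R]_n.+1) :
  is_edm_of_dim (block_mx 0 z^T z D) n <->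
  4 * (e^T *m (z - b)) 0 0 = n.+1%:R * ((z - b)^T *m Bdag *m (z - b)) 0 0.
Proof.
have eT : e^T *m Bdag = 0.
  by rewrite -[Bdag]trmxK -trmx_mul BdagT dag_ones trmx0.
split=> [[r [q [Dq q_dim]]]|kz].
  (* [l] indexes the new point; the centroid [m] of the old points is moved to the origin. *)
  pose f := @rshift 1 n.+1; pose l : 'I_(1 + n.+1) := lshift n.+1 0.
  pose m := n.+1%:R^-1 *: \sum_i q (f i).
  pose q1 i := q (f i) - m; pose x := q l - m; pose Q := points_mx q1.
  have q10 : \sum_i q1 i = 0.
    rewrite sumrB sumr_const card_ord -scaler_nat scalerA divff// scale1r.
    by rewrite subrr.
  have Dq1 : generating_points D q1.
    move=> i j; rewrite /q1 opprB addrA subrK -Dq.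
    by rewrite block_mxEdr.
  have QB : Q *m Q^T = B by exact: centered_gram_unique Dq1 Dp q10 p0.
  (* The direction space has dimension [n] and contains the row space of [Q], whose rank is at least
     [n]. The two coincide, so the new point lies in the span of the old ones. *)
  have /submxP[a xa] : (x^T <= Q)%MS.
    have QA : (Q <= direction_mx q)%MS := points_mx_sub_direction q f.
    apply: submx_trans (sub_centroid_direction q f l) _.
    rewrite -(mxrank_leqif_sup QA) eqn_leq mxrankS//=.
    rewrite [X in (X <= _)%N]q_dim (leq_trans rank_gram_ge)//.
    by rewrite -QB mxrankM_maxl.
  have zE : z = \col_i (enorm (q1 i - x) ^+ 2).
    apply/colP => i; rewrite mxE /q1 /x opprB addrA subrK -Dq.
    by rewrite block_mxEdl.
  have {}xa : x = Q^T *m a^T by rewrite -trmx_mul -xa trmxK.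
  rewrite zE sqdist_vectorE// -/Q.
  set w := _ - _.
  have Bw : Bdag *m w = - (2 *: (Bdag *m Q *m x)).
    by rewrite mulmxBr -!scalemxAr dag_ones scaler0 sub0r mulmxA.
  have ew : e^T *m w = (n.+1%:R * enorm x ^+ 2)%:M.
    rewrite mulmxBr -!scalemxAr mulmxA ones_points_mx// mul0mx scaler0 subr0.
    by rewrite ones_sq scale_scalar_mx mulrC.
  (* The terms in [e] die. Since [x] is [Q^T *m a^T], the rest reduces by [B *m Bdag *m B = B]. *)
  have wBw : w^T *m Bdag *m w = 4 *: (x^T *m x).
    have wT : w^T = enorm x ^+ 2 *: e^T - 2 *: (x^T *m Q^T).
      by rewrite /w raddfB /= !linearZ /= trmx_mul.
    rewrite -mulmxA Bw wT mulmxN mulmxBl -!scalemxAl -!scalemxAr !mulmxA eT.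
    rewrite !mul0mx !scaler0 sub0r opprK scalerA -natrM; congr (_ *: _).
    rewrite xa !trmx_mul !trmxK !mulmxA -(mulmxA a) QB -2!(mulmxA (a *m B)).
    rewrite -(mulmxA Bdag) QB -!(mulmxA a) (mulmxA B).
    by rewrite gram_dag_gram.
  rewrite ew wBw [X in 4 * X]mxE eqxx mulr1n [X in _ = _ * X]mxE -enorm_sq_mul.
  by rewrite mulrCA.
set w := z - b in kz *.
(* Chosen so that [- 2 P x = B Bdag w], which is [w] minus its mean times [e]. It remains that the
   squared norm of [x] is this mean, and that is what [kz] says. *)
pose x : 'cV[R]_n := (- 2^-1) *: ((points_mx p)^T *m (Bdag *m w)).
have xx : 4 * enorm x ^+ 2 = (w^T *m Bdag *m w) 0 0.
  have -> : w^T *m Bdag *m w = 4 *: (x^T *m x).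
    rewrite [x^T]linearZ /= -scalemxAl -scalemxAr !scalerA.
    rewrite !trmx_mul BdagT trmxK !mulmxA -(mulmxA _ (points_mx p)).
    rewrite -(mulmxA w^T Bdag B) -(mulmxA w^T _ Bdag) BdagB.
    by rewrite -[LHS]scale1r; congr (_ *: _); field.
  by rewrite [RHS]mxE enorm_sq_mul.
have zE : z = \col_i (enorm (p i - x) ^+ 2).
  apply: (addIr (- b)); rewrite -/w sqdist_vectorE//.
  rewrite -scalemxAr scalerA mulrN mulfV ?pnatr_eq0// scaleN1r opprK !mulmxA.
  rewrite BBdag mulmxBl mul1mx -scalemxAl -mulmxA [e^T *m w]mx11_scalar.
  rewrite mul_mx_scalar scalerA addrCA -scalerBl.
  suff -> : enorm x ^+ 2 = n.+1%:R^-1 * (e^T *m w) 0 0.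
    by rewrite subrr scale0r addr0.
  apply: (mulfI nS_neq0); rewrite mulVKf//.
  apply: (@mulfI _ 4); first by rewrite pnatr_eq0.
  by rewrite kz -xx mulrCA.
pose q (k : 'I_(1 + n.+1)) := match split k with inl _ => x | inr i => p i end.
have ql i : q (lshift _ i) = x by rewrite /q (unsplitK (inl i)).
have qr i : q (rshift _ i) = p i by rewrite /q (unsplitK (inr i)).
exists n, q; split.
  move=> i j; rewrite -(splitK i) -(splitK j).
  case: (split i) => {}i; case: (split j) => {}j /=; rewrite ?ql ?qr.
  - by rewrite block_mxEul subrr enorm_sqE big1 ?mxE// => k _; rewrite mxE expr0n.
  - rewrite ord1 block_mxEur mxE zE mxE !enorm_sqE.
    by apply: eq_bigr => k _; rewrite !mxE -sqrrN opprB.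
  - by rewrite block_mxEdl ord1 zE mxE.
  by rewrite block_mxEdr Dp.
(* At most [n] because the points lie in dimension [n]; at least [n] because of the old points. *)
apply/eqP; rewrite eqn_leq rank_leq_row (leq_trans rank_gram_ge)//.
rewrite (leq_trans (mxrankM_maxl _ _))// mxrankS//.
have := points_mx_sub_direction q (@rshift 1 n.+1).
congr (_ <= _)%MS; apply/row_matrixP => i; rewrite !rowK.
under eq_bigr do rewrite qr.
by rewrite p0 scaler0 subr0 qr.
Qed.

End Feasibility.

(* Clearing denominators reduces this to the intermediate value theorem for
   polynomials. *)
Lemma sum_div_poly_ivt (R : rcfType) (I : finType) (P : pred I) (a : I -> R)
    (q : I -> {poly R}) (r : {poly R}) (x y : R) :
  let F t := \sum_(i | P i) a i / (q i).[t] + r.[t] in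
  x <= y -> (forall i t, P i -> x <= t <= y -> 0 < (q i).[t]) ->
  F x <= 0 <= F y -> exists2 t, x <= t <= y & F t = 0.
Proof.
move=> F xy q_gt0 /andP[Fx Fy].
pose Q : {poly R} := \prod_(i | P i) q i.
pose N : {poly R} :=
  \sum_(i | P i) a i *: \prod_(j | P j && (j != i)) q j + r * Q.
have Q_gt0 t : x <= t <= y -> 0 < Q.[t].
  by move=> xty; rewrite horner_prod prodr_gt0// => i Pi; apply: q_gt0.
have NE t : x <= t <= y -> N.[t] = F t * Q.[t].
  move=> xty; rewrite hornerD hornerM mulrDl; congr (_ + _).
  rewrite horner_sum mulr_suml; apply: eq_bigr => i Pi.
  rewrite hornerZ /Q [X in _ = _ * X.[t]](bigD1 i)//= hornerM mulrA divfK//.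
  by rewrite gt_eqF// q_gt0.
have xx : x <= x <= y by rewrite lexx.
have yy : x <= y <= y by rewrite xy lexx.
have [|t xty] := poly_ivt xy (p := N).
  rewrite !NE// mulr_le0_ge0 ?(ltW (Q_gt0 _ _))//=.
  by rewrite mulr_ge0 ?(ltW (Q_gt0 _ _)).
rewrite /root NE// mulf_eq0 (gt_eqF (Q_gt0 _ _))// orbF => /eqP Ft.
by exists t.
Qed.

(** * The secular equation: monotonicity and location of its root *)

Section SecularEquation.
Variables (R : rcfType) (I : finType) (P : pred I) (i0 : I) (mu c : I -> R).
Variable kappa : R.
Hypothesis Pi0 : P i0.
Hypothesis mu_gt0 : forall i, P i -> 0 < mu i.
Hypothesis mu_max : forall i, P i -> mu i <= mu i0.
Hypothesis c0 : c i0 != 0.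

Let h := kappa + \sum_(i | P i) c i ^+ 2 / mu i.
Let term l i := c i ^+ 2 / (mu i * (1 - l * mu i) ^+ 2).
Let g l := \sum_(i | P i) term l i + 2 * l - h.

(** For [l <= 0] the value is at least 1; for [l > 0] the largest [mu] is the worst case. *)
Lemma secular_den_gt0 i l : P i -> l < (mu i0)^-1 -> 0 < 1 - l * mu i.
Proof.
move=> Pi l_lt; rewrite subr_gt0; have [l_le0|l_gt0] := lerP l 0.
  by rewrite (le_lt_trans _ ltr01)// mulr_le0_ge0// ltW// mu_gt0.
rewrite (le_lt_trans (ler_wpM2l (ltW l_gt0) (mu_max Pi)))//.
by rewrite -ltr_pdivlMr ?mu_gt0// mul1r.
Qed.

Lemma secular_term_le i l1 l2 : P i -> l1 <= l2 -> l2 < (mu i0)^-1 ->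
  term l1 i <= term l2 i.
Proof.
move=> Pi l12 l2_lt; have l1_lt := le_lt_trans l12 l2_lt.
have d1 := secular_den_gt0 Pi l1_lt; have d2 := secular_den_gt0 Pi l2_lt.
rewrite ler_wpM2l ?sqr_ge0// lef_pV2 ?posrE ?mulr_gt0 ?exprn_gt0 ?mu_gt0//.
rewrite ler_pM2l ?mu_gt0// ler_sqr ?nnegrE ?(ltW d1) ?(ltW d2)//.
by rewrite lerD2l lerN2 ler_pM2r ?mu_gt0.
Qed.

Lemma secular_term_lt l1 l2 : l1 < l2 -> l2 < (mu i0)^-1 ->
  term l1 i0 < term l2 i0.
Proof.
move=> l12 l2_lt; have l1_lt := lt_trans l12 l2_lt.
have d1 := secular_den_gt0 Pi0 l1_lt; have d2 := secular_den_gt0 Pi0 l2_lt.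
rewrite ltr_pM2l ?exprn_even_gt0// ltf_pV2 ?posrE ?mulr_gt0 ?exprn_gt0 ?mu_gt0//.
rewrite ltr_pM2l ?mu_gt0// ltr_sqr ?nnegrE ?(ltW d1) ?(ltW d2)//.
by rewrite ltrD2l ltrN2 ltr_pM2r ?mu_gt0.
Qed.

(** Strictness comes from [2 * l]; the terms of the sum increase weakly. *)
Lemma secular_homo :
  {in `]-oo, (mu i0)^-1[ &, {homo g : l1 l2 / l1 < l2}}.
Proof.
move=> l1 l2 _; rewrite in_itv /= => l2_lt l12.
rewrite ltrD2r ler_ltD ?ltr_pM2l//.
by apply: ler_sum => i Pi; apply: secular_term_le => //; apply: ltW.
Qed.

(** The sign of [kappa] thus decides on which side of 0 the root lies. *)
Lemma secular0 : g 0 = - kappa.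
Proof.
rewrite /g /h mulr0 addr0 opprD addrCA -[RHS]addr0 -sumrB; congr (_ + _).
by rewrite big1// => i _; rewrite /term mul0r subr0 expr1n mulr1 subrr.
Qed.

Lemma secular_ivt x y : x <= y -> y < (mu i0)^-1 -> g x <= 0 <= g y ->
  exists2 l, x <= l <= y & g l = 0.
Proof.
move=> xy y_lt.
pose q i : {poly R} := mu i *: (1 - mu i *: 'X) ^+ 2.
have qE i t : (q i).[t] = mu i * (1 - t * mu i) ^+ 2.
  by rewrite /q hornerZ horner_exp hornerD hornerN hornerZ hornerX hornerC
    [mu i * t]mulrC.
pose r : {poly R} := 2 *: 'X - h%:P.
have gE t : g t = \sum_(i | P i) c i ^+ 2 / (q i).[t] + r.[t].
  rewrite /g -addrA; congr (_ + _); last by rewrite !hornerE.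
  by apply: eq_bigr => i _; rewrite qE.
rewrite !gE => gxy; have [|t xty <-] := sum_div_poly_ivt xy _ gxy.
  move=> i t Pi /andP[_ ty]; have d := secular_den_gt0 Pi (le_lt_trans ty y_lt).
  by rewrite qE mulr_gt0 ?exprn_gt0 ?mu_gt0.
by exists t.
Qed.

(** The linear part cancels the [kappa] inside [h], leaving the sum of
    [term (kappa / 2) i - term 0 i]. The summand at [i0] is negative because [c i0] is nonzero. *)
Lemma secular_neg_half : kappa < 0 -> g (2^-1 * kappa) < 0.
Proof.
move=> k_lt0; have mu0 := mu_gt0 Pi0.
rewrite /g mulrA divff ?pnatr_eq0// mul1r /h opprD addrA addrK.
have t0 i : c i ^+ 2 / mu i = term 0 i.
  by rewrite /term mul0r subr0 expr1n mulr1.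
under [X in _ - X]eq_bigr do rewrite t0.
have k2 : 2^-1 * kappa < 0 by lra.
rewrite subr_lt0 (bigD1 i0)//= [ltRHS](bigD1 i0)//=.
rewrite ltr_leD ?secular_term_lt ?invr_gt0//.
by apply: ler_sum => i /andP[Pi _]; rewrite secular_term_le ?invr_gt0 1?ltW.
Qed.

(** [g] blows up at the pole [(mu i0)^-1]; an explicit point replaces the limit. *)
Lemma secular_pos : 0 < kappa -> exists2 l, 0 < l < (mu i0)^-1 & 0 < g l.
Proof.
move=> k_gt0; have mu0 := mu_gt0 Pi0.
have c2 : 0 < c i0 ^+ 2 by rewrite exprn_even_gt0.
(* This yields [t < 1] below, hence [l > 0]. *)
have h_ge : c i0 ^+ 2 / mu i0 < h + 1.
  rewrite /h (bigD1 i0)//=.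
  have : 0 <= \sum_(i | P i && (i != i0)) c i ^+ 2 / mu i.
    apply: sumr_ge0 => i /andP[Pi _].
    by rewrite divr_ge0 ?sqr_ge0// ltW// mu_gt0.
  by move: (c i0 ^+ 2 / _) (\sum_(_ | _) _) => A B; lra.
have h1 : 0 < h + 1 by apply: lt_trans h_ge; rewrite divr_gt0.
(* At [l] with [1 - l * mu i0 = t] the polar term is [(h + 1) / t], which alone
   exceeds [h]. *)
pose t := c i0 ^+ 2 / mu i0 / (h + 1).
have t_gt0 : 0 < t by rewrite !divr_gt0.
have t_lt1 : t < 1 by rewrite ltr_pdivrMr// mul1r.
pose l := (1 - t) / mu i0.
have l_gt0 : 0 < l by rewrite divr_gt0// subr_gt0.
have l_lt : l < (mu i0)^-1.
  by rewrite -[ltRHS]mul1r ltr_pM2r ?invr_gt0// gtrBl.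
exists l; first by rewrite l_gt0.
have tE : term l i0 = (h + 1) / t.
  rewrite /term divfK ?gt_eqF// subKr.
  have cE : c i0 ^+ 2 = t * mu i0 * (h + 1).
    by rewrite /t; field; rewrite !gt_eqF.
  by rewrite cE; field; rewrite !gt_eqF.
have term_ge : h + 1 < term l i0 by rewrite tE ltr_pdivlMr// gtr_pMr.
have rest_ge0 : 0 <= \sum_(i | P i && (i != i0)) term l i.
  apply: sumr_ge0 => i /andP[Pi _].
  by rewrite divr_ge0 ?sqr_ge0// mulr_ge0 ?sqr_ge0// ltW// mu_gt0.
rewrite /g (bigD1 i0)//=.
move: (term l i0) term_ge (\sum_(_ | _) _) rest_ge0 => A + B.
by move: (l) (h) l_gt0 => L H; lra.
Qed.

(** The root is found in [[0, m]] or [[kappa / 2, 0]] according to the sign of [kappa]; the excluded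
    endpoints have nonzero values of [g]. *)
Lemma secular_root : exists l : R,
  [/\ l < (mu i0)^-1, g l = 0, kappa = 0 -> l = 0,
      0 < kappa -> 0 < l & kappa < 0 -> 2^-1 * kappa < l < 0].
Proof.
have mu0 := mu_gt0 Pi0.
have [k_lt0|k_gt0|k0] := ltrgtP kappa 0; last first.
- by exists 0; split=> //; rewrite ?invr_gt0// secular0 k0 oppr0.
- have [m /andP[m_gt0 m_lt] gm] := secular_pos k_gt0.
  have [|l /andP[l_ge0 l_le] gl] := secular_ivt (ltW m_gt0) m_lt.
    by rewrite secular0 oppr_le0 !ltW.
  have l_gt0 : 0 < l.
    rewrite lt_neqAle l_ge0 andbT; apply/eqP => l0.
    by move: gl k_gt0; rewrite -l0 secular0; lra.
  by exists l; split=> //; first exact: le_lt_trans l_le m_lt; lra.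
have k2 : 2^-1 * kappa < 0 by lra.
have gk := secular_neg_half k_lt0.
have [||l /andP[l_ge l_le] gl] := secular_ivt (ltW k2) _ _; rewrite ?invr_gt0//.
  by rewrite secular0 oppr_ge0 !ltW.
exists l; split=> //; try lra.
  by rewrite (le_lt_trans l_le) ?invr_gt0.
move=> _; rewrite !lt_neqAle l_ge l_le !andbT; apply/andP; split; apply/eqP => lE.
  by move: gk; rewrite lE gl ltxx.
by move: gl k_lt0; rewrite lE secular0; lra.
Qed.

End SecularEquation.

(** * Completing the square in the Lagrangian *)

Section LagrangePoint.
Variables (R : realFieldType) (I : finType) (mu c : I -> R) (l : R).
Hypothesis den_gt0 : forall i, 0 < 1 - l * mu i.

Let v i := - l * (c i / (1 - l * mu i)).

(** The identity [uE] completes the square in [u^2 - l (mu u^2 - 2 c u)], whose vertex is [v]. On a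
    common level set the multiplier terms cancel after summation. *)
Lemma lagrangian_square (u : I -> R) :
  \sum_i (mu i * u i ^+ 2 - 2 * c i * u i) =
    \sum_i (mu i * v i ^+ 2 - 2 * c i * v i) ->
  \sum_i u i ^+ 2 = \sum_i v i ^+ 2 + \sum_i (1 - l * mu i) * (u i - v i) ^+ 2.
Proof.
have uE i : u i ^+ 2 = v i ^+ 2 + (1 - l * mu i) * (u i - v i) ^+ 2 +
    l * ((mu i * u i ^+ 2 - 2 * c i * u i) - (mu i * v i ^+ 2 - 2 * c i * v i)).
  by rewrite /v; field; rewrite gt_eqF.
move=> uv; rewrite (eq_bigr _ (fun i _ => uE i)) !big_split /=.
by rewrite -mulr_sumr sumrB uv subrr mulr0 addr0.
Qed.

(** Written without dividing by [mu i], so that it covers the zero eigenvalue too. *)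
Lemma lagrange_constraint i :
  mu i * v i ^+ 2 - 2 * c i * v i =
    c i ^+ 2 * (2 * l - l ^+ 2 * mu i) / (1 - l * mu i) ^+ 2.
Proof. by rewrite /v; field; rewrite gt_eqF. Qed.

End LagrangePoint.

Lemma orthogonal_mulK (R : comUnitRingType) n (S : 'M[R]_n) (v : 'cV[R]_n) :
  S^T *m S = 1%:M -> S *m (S^T *m v) = v.
Proof. by move=> /mulmx1C SSt; rewrite mulmxA SSt mul1mx. Qed.

(** * The problem in spectral coordinates *)

Section SpectralCoordinates.
Variables (R : realType) (n : nat) (S : 'M[R]_n) (mu : 'rV[R]_n).
Hypothesis StS : S^T *m S = 1%:M.

(** With [M = B Bdag - 1], [Bdag M = 0] kills every row of [S^T M] except row [k], which is [- s^T]
    because [s^T B = 0]. Multiplying back by [S] gives [M = - s s^T]. *)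
Lemma dag_projection (B : 'M[R]_n) (k : 'I_n) :
  let Bdag := S *m diag_mx mu *m S^T in
  Bdag *m B *m Bdag = Bdag -> (forall i, i != k -> mu 0 i != 0) ->
  (col k S)^T *m B = 0 -> B *m Bdag = 1%:M - col k S *m (col k S)^T.
Proof.
move=> Bdag BdagB mu_neq0 sB; set s := col k S.
pose M := B *m Bdag - 1%:M; pose N := S^T *m M.
have N0 i j : i != k -> N i j = 0.
  move=> ik; have : (diag_mx mu *m N) i j = 0.
    have -> : diag_mx mu *m N = S^T *m (Bdag *m M).
      by rewrite /N /Bdag !mulmxA StS mul1mx.
    by rewrite mulmxBr mulmx1 mulmxA BdagB subrr mulmx0 mxE.
  rewrite mul_diag_mx mxE => /eqP.
  by rewrite mulf_eq0 (negPf (mu_neq0 i ik)) => /eqP.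
have Nk j : N k j = - s j 0.
  have -> : N k j = (s^T *m M) 0 j.
    by rewrite !mxE; apply: eq_bigr => i _; rewrite !mxE.
  by rewrite mulmxBr mulmxA sB mul0mx sub0r mulmx1 !mxE.
apply: (addIr (- 1%:M)); rewrite -/M addrAC subrr sub0r.
rewrite -[M]mul1mx -(mulmx1C StS) -mulmxA -/N; apply/matrixP => i j.
rewrite mxE (bigD1 k)//= Nk big1 => [|l lk]; last by rewrite N0 ?mulr0.
by rewrite addr0 !mxE big_ord1 !mxE mulrN.
Qed.

Lemma enorm_spectral (v : 'cV[R]_n) :
  enorm v ^+ 2 = \sum_i (S^T *m v) i 0 ^+ 2.
Proof.
rewrite -enorm_sqE !enorm_sq_mul trmx_mul trmxK mulmxA -(mulmxA _ S).
by rewrite (mulmx1C StS) mulmx1.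
Qed.

Lemma kappa_spectral (e w : 'cV[R]_n) :
  (e^T *m w - w^T *m (S *m diag_mx mu *m S^T) *m w) 0 0 =
  \sum_i ((S^T *m e) i 0 * (S^T *m w) i 0 - mu 0 i * (S^T *m w) i 0 ^+ 2).
Proof.
rewrite sumrB mxE; congr (_ + _).
  have -> : e^T *m w = (S^T *m e)^T *m (S^T *m w).
    by rewrite trmx_mul trmxK -mulmxA orthogonal_mulK.
  by rewrite mxE; apply: eq_bigr => i _; rewrite mxE.
have -> : w^T *m (S *m diag_mx mu *m S^T) *m w =
    (S^T *m w)^T *m (diag_mx mu *m (S^T *m w)).
  by rewrite trmx_mul trmxK !mulmxA.
move: (S^T *m w) => a; rewrite mul_diag_mx !mxE; congr (- _).
by apply: eq_bigr => i _; rewrite !mxE expr2 mulrCA.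
Qed.

(** Taylor expansion at [w]: [c] is half the gradient of [kappa] there, in spectral coordinates. *)
Lemma kappa_shift (e w u : 'cV[R]_n) :
  let c : 'cV[R]_n := - (diag_mx mu *m S^T *m w) + 2^-1 *: (S^T *m e) in
  let kappa x := (e^T *m x - x^T *m (S *m diag_mx mu *m S^T) *m x) 0 0 in
  kappa (u + w) = kappa w -
    \sum_i (mu 0 i * (S^T *m u) i 0 ^+ 2 - 2 * c i 0 * (S^T *m u) i 0).
Proof.
rewrite /= !kappa_spectral -sumrB; apply: eq_bigr => i _.
have -> : (S^T *m (u + w)) i 0 = (S^T *m u) i 0 + (S^T *m w) i 0.
  by rewrite mulmxDr mxE.
rewrite -mulmxA mul_diag_mx; move: (S^T *m w) (S^T *m e) (S^T *m u) => a ee x.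
by rewrite !mxE; field.
Qed.

(** Identifies the closed formula for the optimum with the vertex of the Lagrangian. *)
Lemma spectral_resolventE (c : 'cV[R]_n) l i :
  (forall i, 1 - l * mu 0 i != 0) ->
  (S^T *m (- l *: (S *m invmx (1%:M - l *: diag_mx mu) *m c))) i 0 =
    - l * (c i 0 / (1 - l * mu 0 i)).
Proof.
move=> d_neq0; pose d : 'rV[R]_n := \row_i (1 - l * mu 0 i)^-1.
pose r : 'rV[R]_n := \row_i (1 - l * mu 0 i).
have -> : 1%:M - l *: diag_mx mu = diag_mx r.
  by apply/matrixP => a b; rewrite !mxE; case: eqP => _;
    rewrite ?mulr1n ?mulr0n; ring.
have rd : diag_mx r *m diag_mx d = 1%:M.
  rewrite mulmx_diag; apply/matrixP => a b; rewrite !mxE.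
  by case: eqP => // ->; rewrite mulfV.
have -> : invmx (diag_mx r) = diag_mx d.
  by rewrite -[LHS]mulmx1 -rd mulKmx//; case: (mulmx1_unit rd).
rewrite -scalemxAr !mulmxA StS mul1mx mul_diag_mx !mxE.
by rewrite [_^-1 * _]mulrC.
Qed.

End SpectralCoordinates.

(* Indices are shifted by one: the entries 1, 2, 3, 4 of the text are 0, 1, 2, 3
   in 'I_4. *)
Theorem mainTheorem3 (R : realType) (D : 'M[R]_4) (p : 'I_4 -> 'cV[R]_3)
    (Bdag S : 'M[R]_4) (mu : 'rV[R]_4) (dm : 'cV[R]_4) :
  let e : 'cV[R]_4 := const_mx 1 in
  let P : 'M[R]_(4, 3) := \matrix_(i < 4) (p i)^T in
  let B : 'M[R]_4 := P *m P^T in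
  let b : 'cV[R]_4 := \col_(i < 4) B i i in
  let Lambda : 'M[R]_4 := diag_mx mu in
  let kappa : R :=
    (e^T *m (dm - b) - (dm - b)^T *m Bdag *m (dm - b)) 0 0 in
  let c : 'cV[R]_4 :=
    - (Lambda *m S^T *m (dm - b)) + 2^-1 *: (S^T *m e) in
  let h : R := kappa + \sum_(i < 4 | (i < 3)%N) c i 0 ^+ 2 / mu 0 i in
  let g : R -> R := fun l =>
    \sum_(i < 4 | (i < 3)%N) c i 0 ^+ 2 / (mu 0 i * (1 - l * mu 0 i) ^+ 2)
      + 2 * l - h in
  let ystar : R -> 'cV[R]_4 := fun l =>
    (- l) *: (S *m invmx (1%:M - l *: Lambda) *m c) + dm in
  is_edm_of_dim D 3 ->
  generating_points D p ->
  aff_dim p = 3%N ->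
  \sum_(i < 4) p i = 0 ->
  is_moore_penrose B Bdag ->
  S^T *m S = 1%:M ->
  Bdag = S *m Lambda *m S^T ->
  [/\ mu 0 0 >= mu 0 1, mu 0 1 >= mu 0 2, mu 0 2 > mu 0 3 & mu 0 3 = 0] ->
  col 3 S = 2^-1 *: e ->
  c 0 0 != 0 ->
  {in `]-oo, (mu 0 0)^-1[ &, {homo g : l1 l2 / l1 < l2}} /\
  exists lstar : R,
    [/\ (lstar \in `]-oo, (mu 0 0)^-1[) /\ g lstar = 0,
        forall l : R, (l \in `]-oo, (mu 0 0)^-1[) -> g l = 0 -> l = lstar,
        [/\ kappa = 0 -> lstar = 0,
            kappa > 0 -> (lstar \in `]0, (mu 0 0)^-1[)
          & kappa < 0 -> (lstar \in `]2^-1 * kappa, 0[)],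
        forall y : 'cV[R]_4,
          is_minimizer
            (fun z : 'cV[R]_4 => is_edm_of_dim (block_mx 0 z^T z D) 3)
            (fun z : 'cV[R]_4 => enorm (z - dm) ^+ 2) y
          <-> y = ystar lstar
      & kappa = 0 -> ystar lstar = dm].
Proof.
move=> e P B b Lambda kappa c h g ystar _ Dp _ p0 [_ BdagB _ _] StS BdagE.
move=> [mu01 mu12 mu23 mu3] s3 c0.
have mu2_gt0 : 0 < mu 0 2 by rewrite -mu3.
have mu1_gt0 := lt_le_trans mu2_gt0 mu12.
have mu0_gt0 := lt_le_trans mu1_gt0 mu01.
have I4 (i : 'I_4) : [\/ i = 0, i = 1, i = 2 | i = 3].
  by case: i => -[|[|[|[|//]]]] i_lt;
    [constructor 1|constructor 2|constructor 3|constructor 4]; apply: val_inj.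
have mu_gt0 (i : 'I_4) : (i < 3)%N -> 0 < mu 0 i.
  by case: (I4 i) => ->.
have mu_max (i : 'I_4) : (i < 3)%N -> mu 0 i <= mu 0 0.
  by case: (I4 i) => -> // _; exact: le_trans mu12 mu01.
have i3 (i : 'I_4) : (i < 3)%N = (i != 3) by case: (I4 i) => ->.
(* The secular sum runs over the indices below 3, where [mu] is positive. *)
have g_mono := secular_homo (P := fun i : 'I_4 => (i < 3)%N) (i0 := 0)
  (mu := fun i => mu 0 i) (fun i => c i 0) kappa isT mu_gt0 mu_max.
split; first exact: g_mono.
have [l [l_lt gl l0 l_gt0 l_lt0]] :=
  secular_root (P := fun i : 'I_4 => (i < 3)%N) (i0 := 0)
    (mu := fun i => mu 0 i) (c := fun i => c i 0) kappa isT mu_gt0 mu_max c0.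
exists l.
have den_gt0 i : 0 < 1 - l * mu 0 i.
  have [i_lt|] := boolP (i < 3)%N.
    exact: (secular_den_gt0 (P := fun i : 'I_4 => (i < 3)%N) (i0 := 0)
      (mu := fun i => mu 0 i) isT mu_gt0 mu_max).
  by rewrite i3 negbK => /eqP ->; rewrite mu3 mulr0 subr0.
have Ste : (S^T *m e) 3 0 = 2.
  have -> : (S^T *m e) 3 0 = ((col 3 S)^T *m e) 0 0.
    by rewrite !mxE; apply: eq_bigr => i _; rewrite !mxE.
  rewrite s3 linearZ /= -scalemxAl ones_sq mxE mxE eqxx mulr1n.
  by field.
(* Hence coordinate 3 contributes [2 * l] to [level v]: the linear term of [g]. *)
have c3 : c 3 0 = 1.
  rewrite /c -mulmxA mul_diag_mx mxE [X in X + _]mxE [X in - X + _]mxE mu3 mul0r.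
  by rewrite mxE Ste oppr0 add0r mulVf// pnatr_eq0.
pose u (z : 'cV[R]_4) := S^T *m (z - dm).
pose v i := - l * (c i 0 / (1 - l * mu 0 i)).
have uE i : u (ystar l) i 0 = v i.
  rewrite /u /ystar addrK spectral_resolventE// => j; rewrite gt_eqF//.
pose level (x : 'I_4 -> R) := \sum_i (mu 0 i * x i ^+ 2 - 2 * c i 0 * x i).
(* In general [level v = g l + kappa], so this is the root equation. *)
have level_v : level v = kappa.
  transitivity (\sum_i
      c i 0 ^+ 2 * (2 * l - l ^+ 2 * mu 0 i) / (1 - l * mu 0 i) ^+ 2).
    apply: eq_bigr => i _.
    exact: (lagrange_constraint (mu := fun i => mu 0 i) (fun i => c i 0)).
  rewrite (bigID (fun i : 'I_4 => (i < 3)%N))/=.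
  rewrite [X in _ + X](big_pred1 3) => [|i]; last by rewrite i3 negbK.
  rewrite mu3 c3 !mulr0 !subr0 !expr1n mul1r divr1.
  set A := \sum_(i < 4 | _) _.
  have -> : A =
      \sum_(i < 4 | (i < 3)%N) c i 0 ^+ 2 / (mu 0 i * (1 - l * mu 0 i) ^+ 2) -
      \sum_(i < 4 | (i < 3)%N) c i 0 ^+ 2 / mu 0 i.
    rewrite -sumrB; apply: eq_bigr => i i_lt.
    by field; rewrite !gt_eqF// mu_gt0.
  move: gl; rewrite /g /h.
  move: (\sum_(i < 4 | _) _) (\sum_(i < 4 | _) _) => X Y.
  by lra.
have feasibleP z : is_edm_of_dim (block_mx 0 z^T z D) 3 <->
    level (fun i => u z i 0) = kappa.
  have BdagT : Bdag^T = Bdag.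
    by rewrite BdagE !trmx_mul trmxK tr_diag_mx mulmxA.
  have BBdag : B *m Bdag = 1%:M - 4^-1 *: (e *m e^T).
    rewrite BdagE (dag_projection StS (k := 3)) -?BdagE//.
    - rewrite s3 linearZ /= -scalemxAl -scalemxAr scalerA.
      by congr (_ - _ *: _); field.
    - by move=> i; rewrite -i3 => /mu_gt0; rewrite lt0r => /andP[].
    by rewrite s3 linearZ /= -scalemxAl mulmxA ones_points_mx// mul0mx scaler0.
  have -> : is_edm_of_dim (block_mx 0 z^T z D) 3 <->
      4 * (e^T *m (z - b)) 0 0 = 4 * ((z - b)^T *m Bdag *m (z - b)) 0 0.
    exact: edm_extensionP Dp p0 BdagT BdagB BBdag z.
  (* Expanding at [dm - b] gives [kappa_4(z) = kappa - level (u z)]. *)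
  have := kappa_shift mu StS e (dm - b) (z - dm).
  rewrite /= addrA subrK -BdagE -/Lambda -/c -/kappa -/(u z).
  rewrite [X in X = _]mxE [X in _ + X]mxE -/(level (fun i => u z i 0)).
  move: ((e^T *m (z - b)) 0 0) (((z - b)^T *m Bdag *m (z - b)) 0 0) => A C kz.
  by split; lra.
have costE z : enorm (z - dm) ^+ 2 = \sum_i u z i 0 ^+ 2.
  by exact: enorm_spectral.
have ystar_cost z : is_edm_of_dim (block_mx 0 z^T z D) 3 ->
    enorm (z - dm) ^+ 2 = enorm (ystar l - dm) ^+ 2 +
      \sum_i (1 - l * mu 0 i) * (u z i 0 - v i) ^+ 2.
  move/feasibleP => z_level; rewrite !costE.
  rewrite (lagrangian_square (c := fun i => c i 0) den_gt0
    (u := fun i => u z i 0)).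
    by congr (_ + _); apply: eq_bigr => i _; rewrite uE.
  by rewrite -/v; move: z_level; rewrite /level -level_v.
have rest_ge0 z i : 0 <= (1 - l * mu 0 i) * (u z i 0 - v i) ^+ 2.
  by rewrite mulr_ge0 ?sqr_ge0// ltW.
have ystar_feasible : is_edm_of_dim (block_mx 0 (ystar l)^T (ystar l) D) 3.
  by apply/feasibleP; rewrite -level_v; apply: eq_bigr => i _; rewrite uE.
split.
- by rewrite in_itv.
- move=> l'; rewrite in_itv /= => l'_lt gl'.
  have g_neq l1 l2 : l1 < l2 -> l1 < (mu 0 0)^-1 -> l2 < (mu 0 0)^-1 ->
      g l1 != g l2.
    by move=> l12 l1_lt l2_lt; rewrite lt_eqF// [_ < _]g_mono// in_itv.
  have g_l : g l = 0 by [].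
  have [l'l|ll'|//] := ltrgtP l' l.
    by have := g_neq _ _ l'l l'_lt l_lt; rewrite gl' g_l eqxx.
  by have := g_neq _ _ ll' l_lt l'_lt; rewrite gl' g_l eqxx.
- split=> // k; rewrite in_itv /= ?l_gt0//; exact: l_lt0.
- move=> y; split=> [[y_feasible y_min]|->].
    have := y_min _ ystar_feasible; rewrite (ystar_cost y)// gerDl => rest_le0.
    (* Equal cost makes a sum of nonnegative terms vanish; the coefficients are positive, so
       [u y = v], and [S] recovers [y]. *)
    have /eqP := le_anti (introT andP (conj rest_le0
      (sumr_ge0 _ (fun i _ => rest_ge0 y i)))).
    rewrite psumr_eq0 => [/allP rest0|i _]; last exact: rest_ge0.
    apply: (addIr (- dm)); rewrite -[LHS](orthogonal_mulK _ StS).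
    rewrite -[RHS](orthogonal_mulK _ StS); congr (_ *m _); apply/colP => i.
    rewrite -/(u y) -/(u (ystar l)) uE; apply/eqP; rewrite -subr_eq0.
    by have := rest0 i (mem_index_enum i); rewrite /= mulf_eq0 gt_eqF//= sqrf_eq0.
  split=> // z z_feasible; rewrite (ystar_cost z)// lerDl.
  by apply: sumr_ge0 => i _.
by move=> k0; rewrite /ystar (l0 k0) oppr0 scale0r add0r.
Qed.
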